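(* Let $\theta, a:\mathbb{R}\to\mathbb{R}$ be $C^\infty$ functions and let $\mathcal{L}=\{L_{(\theta(t),a(t))}\}_{t\in\mathbb{R}}$ be the associated straight line family in the plane $\mathbb{R}^2$. Suppose that the Gauss mapping $\nu:\mathbb{R}\to S^1$ of $\mathcal{L}$ is non-singular. Then $\mathcal{L}$ creates a unique envelope, i.e. there exists exactly one envelope $f:\mathbb{R}\to\mathbb{R}^2$ created by $\mathcal{L}$.
   Context: For $C^\infty$ functions $\theta,a:\mathbb{R}\to\mathbb{R}$, the straight line family $\mathcal{L}=\{L_{(\theta(t),a(t))}\}_{t\in\mathbb{R}}$ consists of the lines $L_{(\theta(t),a(t))}=\{(X,Y)\in\mathbb{R}^2 \mid X\cos\theta(t)+Y\sin\theta(t)=a(t)\}$. Its Gauss mapping is $\nu:\mathbb{R}\to S^1$, $\nu(t)=(\cos\theta(t),\sin\theta(t))$. A point $t$ is a regular point of $\nu$ if $\frac{d\nu}{dt}(t)\neq 0$ (equivalently $\frac{d\theta}{dt}(t)\ne 0$), and a singular point otherwise; $\nu$ is non-singular if every $t\in\mathbb{R}$ is a regular point. An envelope created by $\mathcal{L}$ is a $C^\infty$ mapping $f:\mathbb{R}\to\mathbb{R}^2$ such that for every $t\in\mathbb{R}$: (a) $\frac{df}{dt}(t)\cdot\nu(t)=0$ (standard scalar product), and (b) $f(t)\in L_{(\theta(t),a(t))}$. *)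

(* Defs.v *)
From Stdlib Require Import Reals.
From Coquelicot Require Import Coquelicot.
Local Open Scope R_scope.

Definition smooth (g : R -> R) : Prop := forall (n : nat) (t : R), ex_derive_n g n t.

Definition smooth_curve (f : R -> R * R) : Prop :=
  smooth (fun t => fst (f t)) /\ smooth (fun t => snd (f t)).

(* [Derive] is total with an arbitrary value where no derivative exists; below
   it is applied only to curves that are smooth by hypothesis. *)
Definition curve_deriv (f : R -> R * R) (t : R) : R * R :=
  (Derive (fun s => fst (f s)) t, Derive (fun s => snd (f s)) t).

Definition dot (u v : R * R) : R := fst u * fst v + snd u * snd v.

Definition line (theta a : R) (P : R * R) : Prop :=
  fst P * cos theta + snd P * sin theta = a.

Definition line_family (theta a : R -> R) (t : R) : R * R -> Prop :=
  line (theta t) (a t).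

(* Viewed in the ambient plane R^2, where its derivative is taken; its values
   lie on the unit circle by [gauss_unit]. *)
Definition gauss (theta : R -> R) (t : R) : R * R := (cos (theta t), sin (theta t)).

Lemma gauss_unit (theta : R -> R) (t : R) : dot (gauss theta t) (gauss theta t) = 1.
Proof.
  unfold dot, gauss; simpl.
  rewrite Rplus_comm; exact (sin2_cos2 (theta t)).
Qed.

Definition regular_point (nu : R -> R * R) (t : R) : Prop := curve_deriv nu t <> (0, 0).

Definition non_singular (nu : R -> R * R) : Prop := forall t : R, regular_point nu t.

Definition is_envelope (theta a : R -> R) (f : R -> R * R) : Prop :=
  smooth_curve f /\
  forall t : R,
    dot (curve_deriv f t) (gauss theta t) = 0 /\ line_family theta a t (f t).

(* Main.v *)
Require Import Defs.
From Stdlib Require Import Reals Lra FunctionalExtensionality.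
From Coquelicot Require Import Coquelicot.
Local Open Scope R_scope.

(** Write [nu = (cos theta, sin theta)] and let [mu = (- sin theta, cos theta)]
    be its rotation by a right angle, so that [nu' = theta' mu].  If a curve [f]
    satisfies [f . nu = a], differentiating gives
    [f' . nu + theta' (f . mu) = a'].  For a curve that stays on the lines, the
    tangency condition [f' . nu = 0] is therefore the same as the pointwise
    equation [theta' (f . mu) = a'] ([tangency_defect]).  Regularity of [nu]
    means [theta' <> 0], so both coordinates of [f t] in the orthonormal frame
    [(nu, mu)] are prescribed: [a] and [a' / theta'].  That forces
    [f = a nu + (a' / theta') mu], and conversely this curve is an envelope as
    soon as it is smooth ([is_envelope_iff]).

    Smoothness of the formula is a closure property of smooth functions under
    the field operations, sine and cosine.  All these closures are obtained at
    once from a coinduction principle ([smooth_of_derive_closed]): every member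
    of a class of differentiable functions stable under differentiation is
    smooth. *)

Lemma smooth_ex_derive (g : R -> R) (t : R) : smooth g -> ex_derive g t.
Proof. intros hg; exact (hg 1%nat t). Qed.

Lemma smooth_Derive (g : R -> R) : smooth g -> smooth (Derive g).
Proof.
  intros hg [|n] t; [exact I|].
  apply (ex_derive_ext (Derive_n g (S n))); [|exact (hg (S (S n)) t)].
  intros s.
  rewrite <- Nat.add_1_r, <- (Derive_n_comp g n 1).
  reflexivity.
Qed.

(** The [n]-th derivative of a member of the class is again a member, hence
    differentiable. *)
Lemma smooth_of_derive_closed (P : (R -> R) -> Prop) :
  (forall f, P f -> exists g, P g /\ forall t, is_derive f t (g t)) ->
  forall f, P f -> smooth f.
Proof.
  intros hP f hf.
  assert (hn : forall n, exists g, P g /\ forall t, Derive_n f n t = g t).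
  { induction n as [|n [g [hg Eg]]]; [now exists f|].
    destruct (hP g hg) as [g' [hg' Dg]].
    exists g'; split; [exact hg'|]; intros t; simpl.
    rewrite (Derive_ext _ g t Eg).
    exact (is_derive_unique _ _ _ (Dg t)). }
  intros [|n] t; [exact I|].
  destruct (hn n) as [g [hg Eg]].
  destruct (hP g hg) as [g' [_ Dg]].
  apply (ex_derive_ext g); [now intros s|].
  exists (g' t); exact (Dg t).
Qed.

(** Closing the smooth functions syntactically yields a class to which
    coinduction applies; [smooth_closure_smooth] shows that nothing new is
    added. *)
Inductive smooth_closure : (R -> R) -> Prop :=
| closure_base g : smooth g -> smooth_closure g
| closure_plus g h : smooth_closure g -> smooth_closure h ->
    smooth_closure (fun t => g t + h t)
| closure_opp g : smooth_closure g -> smooth_closure (fun t => - g t)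
| closure_mult g h : smooth_closure g -> smooth_closure h ->
    smooth_closure (fun t => g t * h t)
| closure_inv g : smooth_closure g -> (forall t, g t <> 0) ->
    smooth_closure (fun t => / g t)
| closure_cos g : smooth_closure g -> smooth_closure (fun t => cos (g t))
| closure_sin g : smooth_closure g -> smooth_closure (fun t => sin (g t)).

(** The derivation rules express the derivative of each operation through the
    operands and their derivatives, using the same operations only. *)
Lemma smooth_closure_derive (f : R -> R) :
  smooth_closure f ->
  exists g, smooth_closure g /\ forall t, is_derive f t (g t).
Proof.
  induction 1 as [g hg
    | g h hg [g' [hg' Dg]] hh [h' [hh' Dh]]
    | g hg [g' [hg' Dg]]
    | g h hg [g' [hg' Dg]] hh [h' [hh' Dh]]
    | g hg [g' [hg' Dg]] g0
    | g hg [g' [hg' Dg]]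
    | g hg [g' [hg' Dg]]].
  - exists (Derive g); split; [now apply closure_base, smooth_Derive|].
    intros t; now apply Derive_correct, smooth_ex_derive.
  - exists (fun t => g' t + h' t); split; [now apply closure_plus|].
    intros t; exact (is_derive_plus g h t _ _ (Dg t) (Dh t)).
  - exists (fun t => - g' t); split; [now apply closure_opp|].
    intros t; exact (is_derive_opp g t _ (Dg t)).
  - exists (fun t => g' t * h t + g t * h' t); split.
    + now apply closure_plus; apply closure_mult.
    + intros t; exact (is_derive_mult g h t _ _ (Dg t) (Dh t) Rmult_comm).
  - exists (fun t => - (g' t * (/ g t * / g t))); split.
    + apply closure_opp, closure_mult; [exact hg'|].
      now apply closure_mult; apply closure_inv.
    + intros t.
      replace (- (g' t * (/ g t * / g t))) with (- g' t / g t ^ 2)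
        by (field; apply g0).
      exact (is_derive_inv g t _ (Dg t) (g0 t)).
  - exists (fun t => g' t * - sin (g t)); split.
    + apply closure_mult; [exact hg'|]; now apply closure_opp, closure_sin.
    + intros t; exact (is_derive_comp cos g t _ _ (is_derive_cos _) (Dg t)).
  - exists (fun t => g' t * cos (g t)); split.
    + apply closure_mult; [exact hg'|]; now apply closure_cos.
    + intros t; exact (is_derive_comp sin g t _ _ (is_derive_sin _) (Dg t)).
Qed.

Lemma smooth_closure_smooth (f : R -> R) : smooth_closure f -> smooth f.
Proof. exact (smooth_of_derive_closed _ smooth_closure_derive f). Qed.

Lemma is_derive_cos_comp (theta : R -> R) (t : R) :
  ex_derive theta t ->
  is_derive (fun s : R => cos (theta s)) t (- (Derive theta t * sin (theta t))).
Proof.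
  intros h; auto_derive; [exact h|].
  change (Derive (fun s => theta s) t) with (Derive theta t); ring.
Qed.

Lemma is_derive_sin_comp (theta : R -> R) (t : R) :
  ex_derive theta t ->
  is_derive (fun s : R => sin (theta s)) t (Derive theta t * cos (theta t)).
Proof.
  intros h; auto_derive; [exact h|].
  change (Derive (fun s => theta s) t) with (Derive theta t); ring.
Qed.

Lemma regular_point_gauss (theta : R -> R) (t : R) :
  ex_derive theta t -> regular_point (gauss theta) t -> Derive theta t <> 0.
Proof.
  intros h hreg h0; apply hreg; unfold curve_deriv, gauss; simpl.
  f_equal.
  - etransitivity; [exact (is_derive_unique _ _ _ (is_derive_cos_comp theta t h))|].
    rewrite h0; ring.
  - etransitivity; [exact (is_derive_unique _ _ _ (is_derive_sin_comp theta t h))|].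
    rewrite h0; ring.
Qed.

(** Differentiate the identity [f . nu = a].  This turns tangency, a condition
    on the velocity of [f], into one on its position. *)
Lemma tangency_defect (theta a : R -> R) (f : R -> R * R) (t : R) :
  ex_derive theta t ->
  ex_derive (fun s => fst (f s)) t -> ex_derive (fun s => snd (f s)) t ->
  (forall s, line_family theta a s (f s)) ->
  dot (curve_deriv f t) (gauss theta t) =
  Derive a t
  - Derive theta t * dot (f t) (- sin (theta t), cos (theta t)).
Proof.
  intros hth hx hy hf.
  assert (Da : Derive a t =
    Derive (fun s => fst (f s) * cos (theta s) + snd (f s) * sin (theta s)) t).
  { apply Derive_ext; intros s; symmetry; exact (hf s). }
  pose proof (is_derive_cos_comp theta t hth) as Dc.
  pose proof (is_derive_sin_comp theta t hth) as Ds.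
  assert (hc : ex_derive (fun s => cos (theta s)) t) by (eexists; exact Dc).
  assert (hs : ex_derive (fun s => sin (theta s)) t) by (eexists; exact Ds).
  rewrite Derive_plus in Da
    by now apply ex_derive_mult.
  rewrite !Derive_mult in Da by assumption.
  apply is_derive_unique in Dc, Ds.
  rewrite Dc, Ds in Da.
  rewrite Da; unfold dot, curve_deriv, gauss; simpl; ring.
Qed.

(** The curve [a nu + (a' / theta') mu]. *)
Definition envelope_curve (theta a : R -> R) (t : R) : R * R :=
  let b := Derive a t * / Derive theta t in
  (a t * cos (theta t) + - (b * sin (theta t)),
   a t * sin (theta t) + b * cos (theta t)).

Lemma smooth_envelope_curve (theta a : R -> R) :
  smooth theta -> smooth a -> (forall t, Derive theta t <> 0) ->
  smooth_curve (envelope_curve theta a).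
Proof.
  intros hth ha h0.
  pose proof (closure_base _ hth) as cth.
  pose proof (closure_base _ ha) as ca.
  assert (cb : smooth_closure (fun t => Derive a t * / Derive theta t)).
  { apply closure_mult; [now apply closure_base, smooth_Derive|].
    apply closure_inv; [now apply closure_base, smooth_Derive|exact h0]. }
  pose proof (closure_cos _ cth) as cc.
  pose proof (closure_sin _ cth) as cs.
  split; apply smooth_closure_smooth.
  - exact (closure_plus _ _ (closure_mult _ _ ca cc)
             (closure_opp _ (closure_mult _ _ cb cs))).
  - exact (closure_plus _ _ (closure_mult _ _ ca cs) (closure_mult _ _ cb cc)).
Qed.

(** A point of the plane is determined by its coordinates in the orthonormal
    frame [(nu, mu)]. *)
Lemma rotated_frame_coords (phi u v : R) (p : R * R) :
  dot p (cos phi, sin phi) = u /\ dot p (- sin phi, cos phi) = v <->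
  p = (u * cos phi + - (v * sin phi), u * sin phi + v * cos phi).
Proof.
  pose proof (sin2_cos2 phi) as E; unfold Rsqr in E.
  destruct p as [x y]; unfold dot; simpl; split.
  - intros [<- <-]; f_equal.
    + replace x with (x * 1) at 1 by ring; rewrite <- E; ring.
    + replace y with (y * 1) at 1 by ring; rewrite <- E; ring.
  - intros [= -> ->]; split.
    + replace u with (u * 1) at 3 by ring; rewrite <- E; ring.
    + replace v with (v * 1) at 3 by ring; rewrite <- E; ring.
Qed.

(** The line condition fixes the [nu]-coordinate of [f t]; given it at all
    times, tangency fixes the [mu]-coordinate by [tangency_defect]. *)
Lemma is_envelope_iff (theta a : R -> R) (f : R -> R * R) :
  smooth theta -> (forall t, Derive theta t <> 0) ->
  is_envelope theta a f <->
  smooth_curve f /\ forall t, f t = envelope_curve theta a t.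
Proof.
  intros hth h0; unfold is_envelope.
  assert (tan : smooth_curve f -> (forall s, line_family theta a s (f s)) ->
    forall t, dot (curve_deriv f t) (gauss theta t) = Derive a t
      - Derive theta t * dot (f t) (- sin (theta t), cos (theta t))).
  { intros [hx hy] hl t.
    now apply tangency_defect; [apply smooth_ex_derive..|]. }
  split; intros [hf h]; (split; [exact hf|]).
  - intros t; apply rotated_frame_coords; split; [exact (proj2 (h t))|].
    pose proof (tan hf (fun s => proj2 (h s)) t) as E.
    rewrite (proj1 (h t)) in E.
    apply (Rmult_eq_reg_l (Derive theta t)); [|apply h0].
    transitivity (Derive a t); [lra|field; apply h0].
  - assert (hc := fun t => proj2 (rotated_frame_coords _ _ _ _) (h t)).
    assert (hl : forall t, line_family theta a t (f t))
      by exact (fun t => proj1 (hc t)).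
    intros t; split; [|exact (hl t)].
    rewrite (tan hf hl), (proj2 (hc t)); field; apply h0.
Qed.

Theorem corollary2 (theta a : R -> R)
  (htheta : smooth theta) (ha : smooth a)
  (hnu : non_singular (gauss theta)) :
  exists! f : R -> R * R, is_envelope theta a f.
Proof.
  assert (h0 : forall t, Derive theta t <> 0).
  { intros t; apply regular_point_gauss; [now apply smooth_ex_derive|apply hnu]. }
  exists (envelope_curve theta a); split.
  - apply is_envelope_iff; [exact htheta|exact h0|].
    split; [now apply smooth_envelope_curve|reflexivity].
  - intros f hf; apply is_envelope_iff in hf; [|exact htheta|exact h0].
    apply functional_extensionality; intros t; symmetry; apply hf.
Qed.
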